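(* Let $\mathcal{H}=\mathbb{C}^3$ with orthonormal basis $f,e_1,e_2$. For $i=1,2$, let $\theta_i\in(0,\pi/2)$ and set $c_i=\cos\theta_i$, $s_i=\sin\theta_i$. Define operators on $\mathcal{H}$ by $$A_1=e_1f^*,\qquad A_2=e_2f^*,\qquad A_3=(c_1e_1+s_1e_2)f^*,\qquad A_4=(c_2e_1+is_2e_2)f^*,$$ where $i$ in the formula for $A_4$ is the imaginary unit. Then $A_1,A_2,A_3,A_4$ do not have simultaneous coextensions to commuting isometries; that is, there do not exist a complex Hilbert space $\mathcal{K}\supseteq\mathcal{H}$ and pairwise commuting isometries $S_1,S_2,S_3,S_4$ on $\mathcal{K}$ such that each $S_j$ is a coextension of $A_j$ ($1\le j\le 4$).
   Context: For vectors $v,w$ in a complex Hilbert space, $vw^*$ denotes the rank-at-most-one operator $x\mapsto\langle x,w\rangle v$, where the inner product is linear in the first variable. A bounded operator $S$ on a Hilbert space $\mathcal{K}\supseteq\mathcal{H}$ is a coextension of an operator $A$ on $\mathcal{H}$ if, with respect to $\mathcal{K}=\mathcal{H}\oplus\mathcal{H}^\perp$, it has the form $S=\begin{bmatrix}A&0\\ *&*\end{bmatrix}$ (equivalently, $S^*$ leaves $\mathcal{H}$ invariant and $S^*|_{\mathcal{H}}=A^*$). *)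

(* Defs.v *)
From HB Require Import structures.
From mathcomp Require Import all_boot all_order all_algebra.
From mathcomp Require Import sesquilinear spectral.
From mathcomp Require Import all_classical all_reals all_analysis.
From mathcomp Require Import complex.

Set Implicit Arguments.
Unset Strict Implicit.
Unset Printing Implicit Defensive.

Import Order.TTheory GRing.Theory Num.Theory Num.Def.
Import numFieldNormedType.Exports.

Local Open Scope ring_scope.
Local Open Scope complex_scope.

(* In [{dot K for conjC}] and in [dotmx] the inner product is linear in the
   first variable and conjugate-linear in the second. *)
Record hilbertSpace (R : realType) := HilbertSpace {
  hilbert_sort :> completeNormedModType R[i];
  inner : {dot hilbert_sort for conjC};
  inner_norm : forall x : hilbert_sort, `|x| ^+ 2 = inner x x }.

Arguments inner {R h}.

Section Coextension.
Variables (R : realType) (n : nat).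
Local Notation H := 'rV[R[i]]_n.

Definition orthonormal_basis (e : seq H) : Prop :=
  orthonormal (@dotmx R[i] n) e /\ basis_of fullv e.

(* The operator $v w^*$. *)
Definition rank_one (v w : H) (x : H) : H := dotmx x w *: v.

Lemma rank_one_is_linear (v w : H) : linear (rank_one v w).
Proof.
by move=> a x y; rewrite /rank_one linearPl scalerDl scalerA.
Qed.

HB.instance Definition _ (v w : H) :=
  GRing.isLinear.Build R[i] H H *:%R (rank_one v w) (rank_one_is_linear v w).

Variable K : hilbertSpace R.

(* The Hilbert space H is regarded as a subspace of K through an isometric
   linear embedding J. With respect to the decomposition of K into J(H) and its
   orthogonal complement, the two clauses say that the upper left entry of the
   block matrix of S is A and that its upper right entry is 0. *)
Definition coextension (J : {linear H -> K}) (S : {linear K -> K})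
    (A : {linear H -> H}) : Prop :=
  (forall x y : H, inner (S (J x)) (J y) = dotmx (A x) y) /\
  (forall k : K, (forall y : H, inner k (J y) = 0) ->
     forall y : H, inner (S k) (J y) = 0).

(* A linear isometry is automatically bounded. *)
Definition isometric_operator (S : {linear K -> K}) : Prop :=
  forall k : K, `|S k| = `|k|.

End Coextension.

Definition commuting_isometric_coextensions (R : realType) (n m : nat)
    (A : 'I_m -> {linear 'rV[R[i]]_n -> 'rV[R[i]]_n}) : Prop :=
  exists (K : hilbertSpace R) (J : {linear 'rV[R[i]]_n -> K})
         (S : 'I_m -> {linear K -> K}),
    [/\ isometry inner (@dotmx R[i] n) J,
        forall j, isometric_operator (S j),
        forall j k, S j \o S k =1 S k \o S j &
        forall j, coextension J (S j) (A j)].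

(* Main.v *)
(* Since [|A_j f| = |f|], isometric coextensions satisfy [S_j f = v_j], so
   commutativity gives [S_j v_k = S_k v_j]. Put [a = S_1 e1],
   [b = S_1 e2 = S_2 e1] and [d = S_2 e2]; these are unit vectors with [b]
   orthogonal to [a] and [d]. If [v_j = p e1 + q e2], then [S_j e1 = p a + q b]
   and [S_j e2 = p b + q d], and the orthogonality of these two vectors reads
   [p q^* <a, d> + q p^* = 0]. It forces [<a, d> = -1] for [j = 3], where [p] and
   [q] are real, and [<a, d> = 1] for [j = 4], where [q / p] is imaginary. *)
Require Import Defs.
From mathcomp Require Import all_boot all_order all_algebra.
From mathcomp Require Import all_classical all_reals all_analysis.
From mathcomp Require Import complex.
From mathcomp Require Import sesquilinear spectral.

Import Order.TTheory GRing.Theory Num.Theory.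
Local Open Scope ring_scope.

Lemma conj_imaginary (R : realType) : ('i%C : R[i])^* = - 'i%C.
Proof. by apply/eqP; rewrite eq_complex /= oppr0 !eqxx. Qed.

Lemma imaginary_neq0 (R : realType) : 'i%C != 0 :> R[i].
Proof. by rewrite eq_complex /= oner_eq0 andbF. Qed.

Lemma conj_real_complex (R : realType) (x : R) : (x%:C)%C^* = (x%:C)%C.
Proof. exact: conjc_real. Qed.

Lemma cos2Dsin2_complex (R : realType) (t : R) :
  (cos t)%:C%C ^+ 2 + (sin t)%:C%C ^+ 2 = 1.
Proof. by rewrite -!rmorphXn -rmorphD /= cos2Dsin2. Qed.

Lemma dnorm_orthonormal2 (C : numClosedFieldType) (U : lmodType C)
    (form : {dot U for Num.Def.conjC}) (x y : U) (p q : C) :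
  form x x = 1 -> form y y = 1 -> form x y = 0 ->
  form (p *: x + q *: y) (p *: x + q *: y) = p * p^* + q * q^*.
Proof.
move=> xx yy xy; rewrite hnormDd; last first.
  by rewrite linearZl_LR linearZr_LR /= xy !mulr0.
by rewrite /= !dnormZ xx yy !mulr1 !normCK.
Qed.

Lemma orthonormal3_dot (C : numClosedFieldType) (U : lmodType C)
    (form : {dot U for Num.Def.conjC}) (x y z : U) :
  orthonormal form [:: x; y; z] ->
  [/\ form x x = 1, form y y = 1, form z z = 1 & form y z = 0].
Proof.
case/andP=> /and4P[/eqP xx /eqP yy /eqP zz _].
by move=> /= /and3P[_ /andP[/andP[/eqP yz _] _] _].
Qed.

Section HilbertSpace.
Set Implicit Arguments.
Unset Strict Implicit.
Variables (R : realType) (K : hilbertSpace R).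

(** Polarization: expanding the squared norm of [S (x + z)] shows that [S] preserves the real part
    of the inner product; [z = y] and [z = 'i *: y] then recover the real and imaginary parts. *)
Lemma isometric_operator_isometry (S : {linear K -> K}) :
  isometric_operator S -> isometry inner inner S.
Proof.
move=> S_isom x y.
have Sre z :
    inner (S x) (S z) + (inner (S x) (S z))^* = inner x z + (inner x z)^*.
  have /eqP := inner_norm (S (x + z)).
  rewrite S_isom inner_norm (linearD S) !dnormD -!inner_norm !S_isom.
  by move=> /eqP /addrI.
have := Sre ('i%C *: y); have := Sre y.
rewrite (linearZ_LR S) !linearZr_LR /= !rmorphM !conj_imaginary /=.
rewrite rmorphN /= conj_imaginary opprK.
set d := inner x y; set d' := inner (S x) (S y).
set dc := d^*; set dc' := d'^* => re im.
have im' : d' - dc' = d - dc.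
  apply: (mulfI (imaginary_neq0 R)); apply: oppr_inj.
  by rewrite mulrBr opprB addrC -mulNr im mulrBr opprB addrC mulNr.
have two_neq0 : 2 != 0 :> R[i] by rewrite pnatr_eq0.
apply: (mulfI two_neq0); have := congr2 +%R re im'.
by rewrite addrACA [RHS]addrACA !subrr !addr0 -!mulr2n !mulr_natl.
Qed.

(** [S] preserves the orthogonality of [x] and [y]; in the expansion of [inner (S x) (S y)] only the
    [a]-[d] and [b]-[b] terms survive. *)
Lemma pencil_orthogonality (S : {linear K -> K}) (x y a b d : K) (p q : R[i]) :
  isometric_operator S -> inner x y = 0 ->
  S x = p *: a + q *: b -> S y = p *: b + q *: d ->
  inner a b = 0 -> inner b b = 1 -> inner b d = 0 ->
  p * q^* * inner a d + q * p^* = 0.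
Proof.
move=> S_isom xy Sx Sy ab bb bd.
rewrite -xy -(isometric_operator_isometry S_isom x y).
rewrite Sx Sy linearDl !linearDr !linearZl_LR !linearZr_LR /= ab bb bd.
rewrite -![_ *: _]/(_ * _) !mulr0 mulr1 add0r addr0.
by rewrite mulrA [p * _]mulrC -mulrA [p^* * q]mulrC.
Qed.

(* [J (A x)] is the orthogonal projection of [S (J x)] onto the range of [J], and
   a vector with the same norm as its projection equals it. *)
Lemma coextension_of_isometric_vector (n : nat) (J : {linear 'rV[R[i]]_n -> K})
    (S : {linear K -> K}) (A : {linear 'rV[R[i]]_n -> 'rV[R[i]]_n})
    (x : 'rV[R[i]]_n) :
  isometry inner (@dotmx R[i] n) J -> isometric_operator S ->
  coextension J S A -> dotmx (A x) (A x) = dotmx x x -> S (J x) = J (A x).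
Proof.
move=> J_isom /isometric_operator_isometry S_isom [SJ _] Ax_norm.
apply/eqP; rewrite -subr_eq0 -(dnorm_eq0 inner) dnormB S_isom !J_isom SJ.
have -> : (dotmx (A x) (A x))^* = dotmx (A x) (A x).
  by rewrite {2}[dotmx _ _](hermC (@dotmx R[i] n)) expr0 mul1r.
rewrite Ax_norm subr_eq0; apply/eqP; congr (_ + _); exact: Ax_norm.
Qed.

End HilbertSpace.

Local Open Scope complex_scope.

Theorem theorem2p1 (R : realType) (f e1 e2 : 'rV[R[i]]_3)
    (hbasis : orthonormal_basis [:: f; e1; e2])
    (t1 t2 : R) (ht1 : 0 < t1 < pi / 2) (ht2 : 0 < t2 < pi / 2) :
  let v : seq 'rV[R[i]]_3 :=
    [:: e1;
        e2;
        (cos t1)%:C *: e1 + (sin t1)%:C *: e2;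
        (cos t2)%:C *: e1 + ('i * (sin t2)%:C) *: e2] in
  ~ commuting_isometric_coextensions (fun j : 'I_4 => rank_one v`_j f).
Proof.
move=> v [K [J [S [J_isom S_isom S_comm S_coext]]]].
have /orthonormal3_dot[ff e11 e22 e12] := proj1 hbasis.
have v_unit (j : 'I_4) : dotmx v`_j v`_j = 1.
  case: j => [[|[|[|[|j]]]] lt_j4]; [exact: e11|exact: e22| | |discriminate].
    rewrite [LHS](dnorm_orthonormal2 _ _ _ _ _ _ _ e11 e22 e12).
    by rewrite !conj_real_complex -!expr2 cos2Dsin2_complex.
  rewrite [LHS](dnorm_orthonormal2 _ _ _ _ _ _ _ e11 e22 e12).
  rewrite rmorphM /= conj_imaginary !conj_real_complex.
  by rewrite mulrACA mulrN -!expr2 sqr_i opprK mul1r cos2Dsin2_complex.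
have SJf j : S j (J f) = J v`_j.
  rewrite (coextension_of_isometric_vector J_isom (S_isom j) (S_coext j)) /=.
    by rewrite /rank_one ff scale1r.
  by rewrite /rank_one ff scale1r v_unit.
(* This is commutativity of [S j] and [S k] evaluated at [J f]. *)
have SJv (j k : 'I_4) : S j (J v`_k) = S k (J v`_j).
  by rewrite -!SJf; exact: S_comm.
pose j1 : 'I_4 := @Ordinal 4 0 isT; pose j2 : 'I_4 := @Ordinal 4 1 isT.
pose j3 : 'I_4 := @Ordinal 4 2 isT; pose j4 : 'I_4 := @Ordinal 4 3 isT.
set a := S j1 (J e1); set b := S j1 (J e2); set d := S j2 (J e2).
have S2e1 : S j2 (J e1) = b by exact: (SJv j2 j1).
have Sinner j := isometric_operator_isometry (S_isom j).
(* [a] and [b] are images of [J e1] and [J e2] under [S j1], while [b] and [d] are their images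
   under [S j2]. *)
have ab : inner a b = 0 by rewrite Sinner J_isom.
have bb : inner b b = 1 by rewrite Sinner J_isom.
have bd : inner b d = 0 by rewrite -S2e1 Sinner J_isom.
have e12J : inner (J e1) (J e2) = 0 by rewrite J_isom.
have S_pencil (j : 'I_4) p q : v`_j = p *: e1 + q *: e2 ->
    p * q^* * inner a d + q * p^* = 0.
  (* [SJv] turns [S j (J e1)] and [S j (J e2)] into [S j1] and [S j2] applied to [J v_j], where
     linearity applies. *)
  move=> vj; apply: (pencil_orthogonality (S_isom j) e12J _ _ ab bb bd).
    by rewrite [LHS](SJv j j1) vj !linearD !linearZ_LR.
  by rewrite [LHS](SJv j j2) vj !linearD !linearZ_LR /= S2e1.
have cs_neq0 (t : R) : 0 < t < pi / 2 -> (cos t)%:C * (sin t)%:C != 0 :> R[i].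
  case/andP=> t_gt0 t_lt; rewrite mulf_neq0 // fmorph_eq0 gt_eqF //.
    rewrite cos_gt0_pihalf // t_lt andbT (lt_trans _ t_gt0) //.
    by rewrite oppr_lt0 divr_gt0 ?pi_gt0.
  rewrite sin_gt0_pi // t_gt0 (lt_trans t_lt) //.
  by rewrite ltr_pdivrMr // ltr_pMr ?pi_gt0 ?ltr1n.
have ad_eqN1 : inner a d = -1.
  apply/eqP; rewrite -addr_eq0; apply/eqP/(mulfI (cs_neq0 _ ht1)).
  have := S_pencil j3 _ _ erefl; rewrite !conj_real_complex.
  by rewrite mulr0 mulrDr mulr1 [X in _ + X = 0]mulrC.
(* With [inner a d = -1] and [q] imaginary, the two terms of the relation coincide instead of
   cancelling: it reads [2 i c s = 0], where [c] and [s] are the cosine and sine of [t2]. *)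
have := S_pencil j4 _ _ erefl.
rewrite rmorphM /= conj_imaginary !conj_real_complex ad_eqN1.
rewrite mulrN1 mulNr mulrN opprK.
rewrite [_ * (cos t2)%:C]mulrC -mulr2n => /eqP.
by rewrite mulrn_eq0 /= mulrCA mulf_eq0 (negPf (imaginary_neq0 R))
  (negPf (cs_neq0 _ ht2)).
Qed.
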